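(* Consider a planar spider mechanism with feet $A_1,\dots,A_n$ and smooth spider space $\mathcal{S}$, and let $w_1,\dots,w_n\in\mathbb{R}$ be weights (negative weights are allowed) with $\sum_i w_i\neq 0$. Then the weighted Hooke energy $\mathbb{H}_w$ and the squared distance to the weighted centre of gravity $Z_w$, i.e. the function $\xi\mapsto\|\pi(\xi)-z_w\|^2$, have equivalent critical point theory on the spider space $\mathcal{S}$.
   Context: Points of $\mathbb{R}^2$ are denoted by capital letters and the corresponding vectors by lower-case letters. An $n$-legged planar spider mechanism consists of pairwise distinct fixed points (feet) $A_1,\dots,A_n\in\mathbb{R}^2$, integers $p_1,\dots,p_n>1$, and lengths $\ell_{i,j}>0$ ($1\le i\le n$, $1\le j\le p_i$). A configuration (spider) $\xi$ consists of a point $X\in\mathbb{R}^2$ (the body) and joints $A_i^1,\dots,A_i^{p_i-1}\in\mathbb{R}^2$ for each $i$ such that, with $A_i^0=A_i$ and $A_i^{p_i}=X$, one has $|A_i^{j-1}A_i^{j}|=\ell_{i,j}$ for all $i$ and $1\le j\le p_i$. The $i$-th leg is aligned if the points $A_i^0,\dots,A_i^{p_i}$ lie on one straight line. The spider space $\mathcal{S}$ is the set of all configurations, and the work map $\pi:\mathcal{S}\to\mathbb{R}^2$ sends $\xi$ to its body $X$. The spider space is called smooth if no configuration has two aligned legs lying in one and the same straight line, and no configuration has three aligned legs; then $\mathcal{S}$ is a smooth compact manifold. The weighted Hooke potential is $H_w(x)=\sum_{i=1}^n w_i\|x-a_i\|^2$ for $x\in\mathbb{R}^2$, and the weighted Hooke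 energy on $\mathcal{S}$ is $\mathbb{H}_w(\xi)=H_w(\pi(\xi))$. The weighted centre of gravity $Z_w$ is given by $z_w=\frac{1}{\sum_i w_i}\sum_{i=1}^n w_ia_i$. The phrase ''equivalent critical point theory'' is used informally; depending on the signs of the weights, the indices of critical points can become dual. *)

(* Defs.v *)
From HB Require Import structures.
From mathcomp Require Import all_boot all_order all_algebra.
From mathcomp Require Import all_classical all_reals all_analysis.

Set Implicit Arguments.
Unset Strict Implicit.
Unset Printing Implicit Defensive.

Import Order.TTheory GRing.Theory Num.Theory.
Import numFieldNormedType.Exports.

Local Open Scope classical_set_scope.
Local Open Scope ring_scope.

(* On an open subset of a finite-dimensional space, being C^k is equivalent to
   having all iterated directional derivatives of order <= k, all continuous. *)
Fixpoint Ck_on (R : realType) (V W : normedModType R) (U : set V) (k : nat)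
    (f : V -> W) : Prop :=
  (forall x, U x -> {for x, continuous f}) /\
  (if k is k'.+1 then
     forall v : V, (forall x, U x -> derivable f x v) /\ Ck_on U k' ('D_v f)
   else True).

Definition smooth_on (R : realType) (V W : normedModType R) (U : set V)
    (f : V -> W) : Prop :=
  forall k, Ck_on U k f.

(* Smooth parametrization of a neighbourhood of [xi] in [M] by an open subset
   [U] of R^d: an immersion which is a homeomorphism of [U] onto a relatively
   open subset of [M], centred at [xi]. The values of [phi] outside [U] are
   irrelevant. *)
Record local_parametrization (R : realType) (E : normedModType R) (M : set E)
    (d : nat) (xi : E) (U : set 'rV[R]_d) (phi : 'rV[R]_d -> E) : Prop := {
  param_open : open U;
  param_dom0 : U 0;
  param_centre : phi 0 = xi;
  param_smooth : smooth_on U phi;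
  param_immersion : forall u v, U u -> 'D_v phi u = 0 -> v = 0;
  param_image : exists2 O : set E, open O & phi @` U = M `&` O;
  param_inverse : exists2 psi : E -> 'rV[R]_d,
      {within phi @` U, continuous psi} & forall u, U u -> psi (phi u) = u
}.

Definition hessian (R : realType) (d : nat) (h : 'rV[R]_d -> R)
    (u : 'rV[R]_d) : 'M[R]_d :=
  \matrix_(i < d, j < d) 'D_(delta_mx 0 i) ('D_(delta_mx 0 j) h) u.

Definition negative_definite_on (R : realType) (d : nat) (A V : 'M[R]_d) :
    Prop :=
  forall u : 'rV[R]_d, (u <= V)%MS -> u != 0 -> (u *m A *m u^T) 0 0 < 0.

(* [k] is the maximal dimension of a subspace (the row space of [V]) on which
   the quadratic form of [A] is negative definite. *)
Definition negative_index (R : realType) (d : nat) (A : 'M[R]_d) (k : nat) :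
    Prop :=
  (exists2 V : 'M[R]_d, negative_definite_on A V & \rank V = k) /\
  (forall V : 'M[R]_d, negative_definite_on A V -> (\rank V <= k)%N).

(* For a d-dimensional submanifold [M], the notions below do not depend on the
   local parametrization, and only depend on the restriction of [f] to [M]. *)

Definition critical_point (R : realType) (E : normedModType R) (M : set E)
    (d : nat) (f : E -> R) (xi : E) : Prop :=
  exists (U : set 'rV[R]_d) (phi : 'rV[R]_d -> E),
    local_parametrization M xi U phi /\ forall v, 'D_v (f \o phi) 0 = 0.

(* [xi] is a critical point whose Hessian has nullity [m] and Morse index [k];
   it is nondegenerate iff [m = 0]. *)
Definition critical_point_of_type (R : realType) (E : normedModType R)
    (M : set E) (d : nat) (f : E -> R) (xi : E) (m k : nat) : Prop :=
  exists (U : set 'rV[R]_d) (phi : 'rV[R]_d -> E),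
    [/\ local_parametrization M xi U phi,
        forall v, 'D_v (f \o phi) 0 = 0,
        (d - \rank (hessian (f \o phi) 0))%N = m
      & negative_index (hessian (f \o phi) 0) k].

(* Same critical points, with the same nullities and Morse indices, and the
   same filtration of [M] by sublevel sets. *)
Definition same_critical_theory (R : realType) (E : normedModType R)
    (M : set E) (d : nat) (f g : E -> R) : Prop :=
  [/\ forall xi, M xi ->
        (critical_point M d f xi <-> critical_point M d g xi),
      forall xi m k, M xi ->
        (critical_point_of_type M d f xi m k <->
         critical_point_of_type M d g xi m k)
    & forall xi eta, M xi -> M eta -> (f xi <= f eta) = (g xi <= g eta)].

(* Same critical points with the same nullities, and dual Morse indices: an
   index [k] becomes [d - k] at a nondegenerate critical point, and [d - m - k]
   at one of nullity [m]; sublevel sets become superlevel sets. *)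
Definition dual_critical_theory (R : realType) (E : normedModType R)
    (M : set E) (d : nat) (f g : E -> R) : Prop :=
  [/\ forall xi, M xi ->
        (critical_point M d f xi <-> critical_point M d g xi),
      forall xi m k, M xi -> (m + k <= d)%N ->
        (critical_point_of_type M d f xi m k <->
         critical_point_of_type M d g xi m (d - m - k))
    & forall xi eta, M xi -> M eta -> (f xi <= f eta) = (g eta <= g xi)].

(* The norm provided by the library on ['rV_2] is the sup norm. *)
Definition enorm (R : realType) (x : 'rV[R]_2) : R :=
  Num.sqrt (\sum_(k < 2) x 0 k ^+ 2).

(* The bars of a leg are numbered from 0: bar [j] joins the points number [j]
   and [j.+1] of the leg. *)
Record spider_mechanism (R : realType) (n : nat) := SpiderMechanism {
  foot : 'I_n -> 'rV[R]_2;
  nbars : 'I_n -> nat;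
  bar_length : forall i : 'I_n, 'I_(nbars i) -> R;
  foot_inj : injective foot;
  nbars_gt1 : forall i, (1 < nbars i)%N;
  bar_length_gt0 : forall i (j : 'I_(nbars i)), 0 < bar_length j
}.

(* The movable points: [None] is the body, [Some (i, j)] the (j+1)-st joint of
   the i-th leg. *)
Definition movable (R : realType) (n : nat) (S : spider_mechanism R n) :
    finType :=
  option {i : 'I_n & 'I_(nbars S i).-1}.

(* Ambient space of the spider space: one point of the plane, written as a
   row, for each movable point. *)
Definition ambient (R : realType) (n : nat) (S : spider_mechanism R n) :
    normedModType R :=
  'M[R]_(#|movable S|, 2).

Definition movable_pos (R : realType) (n : nat) (S : spider_mechanism R n)
    (xi : ambient S) (v : movable S) : 'rV[R]_2 :=
  row (enum_rank v) xi.

(* The work map. *)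
Definition body (R : realType) (n : nat) (S : spider_mechanism R n)
    (xi : ambient S) : 'rV[R]_2 :=
  movable_pos xi None.

Definition joint (R : realType) (n : nat) (S : spider_mechanism R n)
    (xi : ambient S) (i : 'I_n) (j : 'I_(nbars S i).-1) : 'rV[R]_2 :=
  movable_pos xi (Some (Tagged (fun i => 'I_(nbars S i).-1) j)).

(* Point number [j] of the i-th leg: the foot for [j = 0], the j-th joint for
   [0 < j < nbars S i], and the body for [j = nbars S i]. *)
Definition leg_point (R : realType) (n : nat) (S : spider_mechanism R n)
    (xi : ambient S) (i : 'I_n) (j : nat) : 'rV[R]_2 :=
  if j is j'.+1 then
    if insub j' is Some k then joint xi (i := i) k else body xi
  else foot S i.

Definition spider_space (R : realType) (n : nat) (S : spider_mechanism R n) :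
    set (ambient S) :=
  [set xi | forall (i : 'I_n) (j : 'I_(nbars S i)),
     enorm (leg_point xi i j.+1 - leg_point xi i j) = bar_length j].

(* Two coordinates per movable point, minus one for each bar; there is no
   truncation since [1 < nbars S i]. *)
Definition spider_dim (R : realType) (n : nat) (S : spider_mechanism R n) :
    nat :=
  (2 + \sum_(i < n) nbars S i - 2 * n)%N.

(* The i-th leg lies in the straight line through [q] with direction [u]
   (meant for [u != 0]). *)
Definition leg_in_line (R : realType) (n : nat) (S : spider_mechanism R n)
    (xi : ambient S) (i : 'I_n) (q u : 'rV[R]_2) : Prop :=
  forall j : nat, (j <= nbars S i)%N ->
    exists t : R, leg_point xi i j = q + t *: u.

Definition aligned (R : realType) (n : nat) (S : spider_mechanism R n)
    (xi : ambient S) (i : 'I_n) : Prop :=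
  exists q u : 'rV[R]_2, u != 0 /\ leg_in_line xi i q u.

Definition smooth_spider_space (R : realType) (n : nat)
    (S : spider_mechanism R n) : Prop :=
  forall xi : ambient S, spider_space xi ->
    (forall i k : 'I_n, i != k ->
       ~ exists q u : 'rV[R]_2,
           [/\ u != 0, leg_in_line xi i q u & leg_in_line xi k q u]) /\
    (forall i j k : 'I_n, i != j -> i != k -> j != k ->
       ~ [/\ aligned xi i, aligned xi j & aligned xi k]).

Definition hooke_potential (R : realType) (n : nat) (S : spider_mechanism R n)
    (w : 'I_n -> R) (x : 'rV[R]_2) : R :=
  \sum_(i < n) w i * enorm (x - foot S i) ^+ 2.

Definition hooke_energy (R : realType) (n : nat) (S : spider_mechanism R n)
    (w : 'I_n -> R) (xi : ambient S) : R :=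
  hooke_potential S w (body xi).

Definition gravity_centre (R : realType) (n : nat) (S : spider_mechanism R n)
    (w : 'I_n -> R) : 'rV[R]_2 :=
  (\sum_(i < n) w i)^-1 *: \sum_(i < n) w i *: foot S i.

Definition sqdist_to_gravity_centre (R : realType) (n : nat)
    (S : spider_mechanism R n) (w : 'I_n -> R) (xi : ambient S) : R :=
  enorm (body xi - gravity_centre S w) ^+ 2.

(* Main.v *)
(* By the parallel axis theorem, [H_w x = W * |x - z_w|^2 + H_w z_w] with
   [W] the sum of the weights, so in any parametrization the derivatives of the
   two functions differ by the factor [W]. For [W > 0] nothing else is needed.
   For [W < 0] the index of the negated Hessian is wanted: the Hessian is
   symmetric (Schwarz) and Sylvester's law of inertia applies. *)

Require Import Defs.
From mathcomp Require Import all_boot all_order all_algebra.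
From mathcomp Require Import all_classical all_reals all_analysis.
From mathcomp Require Import ring lra zify.

Import Order.TTheory GRing.Theory Num.Theory.
Import numFieldNormedType.Exports.

Local Open Scope classical_set_scope.
Local Open Scope ring_scope.

Set Implicit Arguments.
Unset Strict Implicit.

(** * Calculus of $C^k$ maps on an open set, up to Schwarz's theorem *)

Section Ck.
Variables (R : realType) (V : normedModType R) (U : set V).
Hypothesis openU : open U.

Lemma Ck_on_pred (W : normedModType R) k (f : V -> W) :
  Ck_on U k.+1 f -> Ck_on U k f.
Proof.
elim: k f => [|k IH] f [cf df]; split => // v; have [dfv Cdfv] := df v.
by split => //; exact: IH.
Qed.

Lemma nbhs_open_eq (W : Type) (f g : V -> W) (x : V) :
  (forall y, U y -> f y = g y) -> U x -> \near x, f x = g x.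
Proof.
by move=> fg Ux; near=> y; apply: fg; near: y; exact: open_nbhs_nbhs.
Unshelve. all: by end_near. Qed.

(** As [U] is open, a derivative at a point of [U] sees only values in [U]. This allows a derivative
    formula valid only on [U] to be substituted under [Ck_on]. *)
Lemma Ck_on_ext (W : normedModType R) k (f g : V -> W) :
  (forall y, U y -> f y = g y) -> Ck_on U k f -> Ck_on U k g.
Proof.
elim: k f g => [|k IH] f g fg [cf df].
  split => // x Ux; rewrite /prop_for /continuous_at -(fg _ Ux).
  exact: cvg_trans (near_eq_cvg (nbhs_open_eq fg Ux)) (cf _ Ux).
split=> [x Ux|v].
  rewrite /prop_for /continuous_at -(fg _ Ux).
  exact: cvg_trans (near_eq_cvg (nbhs_open_eq fg Ux)) (cf _ Ux).
have [dfv Cdfv] := df v; split => [x Ux|].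
  by apply: near_eq_derivable (dfv _ Ux); exact: nbhs_open_eq.
apply: IH Cdfv => y Uy; apply: near_eq_derive; exact: nbhs_open_eq.
Qed.

Lemma Ck_on_cst (W : normedModType R) k (c : W) : Ck_on U k (cst c : V -> W).
Proof.
elim: k c => [|k IH] c; split => //; try by move=> x _; exact: cvg_cst.
move=> v; split=> [x _|]; first exact: derivable_cst.
by apply: Ck_on_ext (IH 0) => y _; rewrite derive_cst.
Qed.

Lemma Ck_onD (W : normedModType R) k (f g : V -> W) :
  Ck_on U k f -> Ck_on U k g -> Ck_on U k (f + g).
Proof.
elim: k f g => [|k IH] f g [cf df] [cg dg]; split => //.
- by move=> x Ux; apply: cvgD; [exact: cf|exact: cg].
- by move=> x Ux; apply: cvgD; [exact: cf|exact: cg].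
move=> v; have [dfv Cf] := df v; have [dgv Cg] := dg v; split=> [x Ux|].
  by apply: derivableD; [exact: dfv|exact: dgv].
apply: Ck_on_ext (IH _ _ Cf Cg) => y Uy.
by rewrite deriveD//; [exact: dfv|exact: dgv].
Qed.

Lemma Ck_onM k (f g : V -> R) :
  Ck_on U k f -> Ck_on U k g -> Ck_on U k (f * g).
Proof.
elim: k f g => [|k IH] f g Cf Cg; have [cf df] := Cf; have [cg dg] := Cg.
  by split => // x Ux; apply: cvgM; [exact: cf|exact: cg].
split=> [x Ux|v]; first by apply: cvgM; [exact: cf|exact: cg].
have [dfv Cfv] := df v; have [dgv Cgv] := dg v; split=> [x Ux|].
  by apply: derivableM; [exact: dfv|exact: dgv].
(* In the Leibniz rule the undifferentiated factors are used at order [k] only, hence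
   [Ck_on_pred]. *)
apply: Ck_on_ext (Ck_onD (IH _ _ (Ck_on_pred Cf) Cgv)
                         (IH _ _ (Ck_on_pred Cg) Cfv)) => y Uy.
by rewrite deriveM//; [exact: dfv|exact: dgv].
Qed.

Lemma Ck_on_coord m n k (f : V -> 'M[R]_(m, n)) i j :
  Ck_on U k f -> Ck_on U k (fun x => f x i j).
Proof.
elim: k f => [|k IH] f [cf df].
  split=> // x Ux.
  exact: (continuous_comp (cf x Ux) (@coord_continuous _ _ _ i j _)).
split=> [x Ux|v].
  exact: (continuous_comp (cf x Ux) (@coord_continuous _ _ _ i j _)).
have [dfv Cfv] := df v; split=> [x Ux|].
  by have /derivable_mxP := dfv x Ux; exact.
apply: Ck_on_ext (IH _ Cfv) => y Uy.
by rewrite (derive_mx (dfv y Uy)) mxE.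
Qed.

(** Both difference quotients are the same function of [r]. This brings directional derivatives
    within reach of the one-variable mean value theorem. *)
Lemma is_derive_line (W : normedModType R) (h : V -> W) (u v : V) (s : R) :
  derivable h (s *: v + u) v ->
  is_derive s 1 (fun r : R => h (r *: v + u)) ('D_v h (s *: v + u)).
Proof.
have e : (fun r : R => r^-1 *: (((fun r : R => h (r *: v + u)) \o shift s)
              (r *: 1) - h (s *: v + u)))
   = (fun r => r^-1 *: ((h \o shift (s *: v + u)) (r *: v) - h (s *: v + u))).
  by apply/funext => r /=; rewrite scaler1 scalerDl addrA.
move=> dh; split; first by rewrite /derivable e.
by rewrite /derive e.
Qed.

Lemma MVT_is_derive (F dF : R -> R) (t : R) :
  0 < t -> (forall r, 0 <= r <= t -> is_derive r 1 F (dF r)) ->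
  exists2 a, 0 < a < t & F t - F 0 = dF a * t.
Proof.
move=> t0 dF0.
have [||a] := @MVT R F dF 0 t t0.
- by move=> r; rewrite in_itv/= => /andP[r0 rt]; apply: dF0; rewrite !ltW.
- apply: derivable_within_continuous => r; rewrite in_itv/= => rt.
  by have [] := dF0 r rt.
by rewrite in_itv/= subr0; exists a.
Qed.

(* The mean value theorem, applied in turn to
   [r |-> h (u + r v + t w) - h (u + r v)] and
   [r |-> 'D_v h (u + a v + r w)]. *)
Lemma second_difference_MVT (h : V -> R) (u v w : V) (t : R) :
  0 < t -> Ck_on U 2 h ->
  (forall a b, 0 <= a <= t -> 0 <= b <= t -> U (a *: v + b *: w + u)) ->
  exists a b, [/\ 0 < a < t, 0 < b < t &
    h (t *: v + t *: w + u) - h (t *: v + u) - h (t *: w + u) + h u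
      = 'D_w ('D_v h) (a *: v + b *: w + u) * t ^+ 2].
Proof.
move=> t0 [_ /(_ v)[dv [_ /(_ w)[dvw _]]]] inU.
have tt : 0 <= t <= t by rewrite lexx ltW.
have zt : (0 : R) <= 0 <= t by rewrite lexx ltW.
pose F (r : R) := h (r *: v + (t *: w + u)) - h (r *: v + u).
have dF r : 0 <= r <= t -> is_derive r 1 F
    ('D_v h (r *: v + (t *: w + u)) - 'D_v h (r *: v + u)).
  move=> rt; apply: is_deriveB; apply: is_derive_line; apply: dv.
    by rewrite addrA; exact: inU.
  by have := inU r 0 rt zt; rewrite scale0r addr0.
have [a a0t Fa] := MVT_is_derive t0 dF.
have at' : 0 <= a <= t by case/andP: a0t => a0 a1; rewrite !ltW.
pose G (r : R) := 'D_v h (r *: w + (a *: v + u)).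
have dG r : 0 <= r <= t -> is_derive r 1 G
    ('D_w ('D_v h) (r *: w + (a *: v + u))).
  move=> rt; apply: is_derive_line; apply: dvw.
  by rewrite addrCA addrA; exact: inU.
have [b b0t Gb] := @MVT_is_derive G (fun r => 'D_w ('D_v h) (r *: w + (a *: v + u))) t t0 dG.
exists a, b; split => //.
have z0 (x y : V) : 0 *: x + y = y by rewrite scale0r add0r.
rewrite /F /G in Fa Gb; rewrite !z0 in Fa Gb.
rewrite !(addrCA _ (a *: v)) in Gb.
rewrite expr2 mulrA -!addrA -Gb -Fa.
set h1 := h _; set h2 := h _; set h3 := h _; ring.
Qed.

(** The common value is close to both [p u] and [q u]. The points [x] and [y] may differ, because
    two applications of the mean value theorem give unrelated intermediate points. *)
Lemma continuous_eq_meet (p q : V -> R) (u : V) :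
  {for u, continuous p} -> {for u, continuous q} ->
  (forall d, 0 < d -> exists x y, [/\ ball u d x, ball u d y & p x = q y]) ->
  p u = q u.
Proof.
move=> cp cq meet; apply/eqP; rewrite -subr_eq0 -normr_le0.
apply/ler_addgt0Pr => e e0; rewrite add0r.
have e2 : 0 < e / 2 by rewrite divr_gt0.
have /cvgrPdist_lt/(_ _ e2)/nbhs_ballP[d1 /= d10 Hp] := cp.
have /cvgrPdist_lt/(_ _ e2)/nbhs_ballP[d2 /= d20 Hq] := cq.
have [|x [y [ux uy pq]]] := meet (Num.min d1 d2); first by rewrite lt_min d10.
have /Hp/= px : ball u d1 x by apply: le_ball ux; rewrite ge_min lexx.
have /Hq/= qy : ball u d2 y by apply: le_ball uy; rewrite ge_min lexx orbT.
rewrite [e]splitr ltW// (le_lt_trans _ (ltrD px qy))//.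
by rewrite -pq [X in _ <= _ + X]distrC; exact: ler_distD.
Qed.

(** The second difference of [h] over the parallelogram with sides [t v] and [t w] is symmetric in
    [v] and [w]. Divided by [t ^+ 2], it is a value of each mixed derivative at some point of the
    parallelogram, which shrinks to [u]. *)
Lemma derive_comm (h : V -> R) (u v w : V) : U u -> Ck_on U 2 h ->
  'D_w ('D_v h) u = 'D_v ('D_w h) u.
Proof.
move=> Uu Ch.
have [_ /(_ v)[_ [_ /(_ w)[_ [cvw _]]]]] := Ch.
have [_ /(_ w)[_ [_ /(_ v)[_ [cwv _]]]]] := Ch.
apply: continuous_eq_meet (cvw u Uu) (cwv u Uu) _ => e e0.
have [r /= r0 rU] := (nbhs_ballP _ _).1 (open_nbhs_nbhs (conj openU Uu)).
pose d := Num.min e r.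
have d0 : 0 < d by rewrite lt_min e0.
(* With this side the whole parallelogram lies within [d] of [u]; the [1] keeps the denominator
   positive when [v] and [w] both vanish. *)
pose t := d / (`|v| + `|w| + 1).
have c0 : 0 < `|v| + `|w| + 1 by rewrite ltr_wpDl// addr_ge0.
have t0 : 0 < t by rewrite divr_gt0.
have in_ball a b : 0 <= a <= t -> 0 <= b <= t ->
    ball u d (a *: v + b *: w + u).
  move=> /andP[a0 at'] /andP[b0 bt]; rewrite -ball_normE /=.
  rewrite opprD addrCA subrr addr0 normrN (le_lt_trans (ler_normD _ _))//.
  rewrite !normrZ !ger0_norm//.
  apply: (@le_lt_trans _ _ (t * (`|v| + `|w|))).
    by rewrite mulrDr lerD// ler_wpM2r.
  by rewrite /t -mulrA gtr_pMr// mulrC ltr_pdivrMr// mul1r ltrDl.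
have inU a b : 0 <= a <= t -> 0 <= b <= t -> U (a *: v + b *: w + u).
  move=> at' bt; apply: rU; apply: le_ball (in_ball _ _ at' bt).
  by rewrite ge_min lexx orbT.
have inU' a b : 0 <= a <= t -> 0 <= b <= t -> U (a *: w + b *: v + u).
  by move=> at' bt; rewrite (addrC (a *: w)); exact: inU.
have in_e a b : 0 < a < t -> 0 < b < t -> ball u e (a *: v + b *: w + u).
  move=> /andP[a0 at'] /andP[b0 bt].
  apply: le_ball (in_ball a b _ _); last 2 first.
  - by rewrite !ltW.
  - by rewrite !ltW.
  by rewrite ge_min lexx.
have [a [b [a0 b0 E1]]] := second_difference_MVT t0 Ch inU.
have [b' [a' [b0' a0' E2]]] := second_difference_MVT t0 Ch inU'.
exists (a *: v + b *: w + u), (a' *: v + b' *: w + u).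
split; [exact: in_e|exact: in_e|].
have cancel (p q x y : R) : x = p * t ^+ 2 -> y = q * t ^+ 2 -> x = y -> p = q.
  by move=> -> ->; apply: mulIf; rewrite expf_neq0// gt_eqF.
rewrite (addrC (b' *: w)) in E2; rewrite (addrC (t *: w)) in E2.
apply: (cancel _ _ _ _ E1 E2).
by set h1 := h _; set h2 := h _; set h3 := h _; ring.
Qed.

End Ck.

(** * Quadratic forms: the negative index under negation and scaling *)

Section Inertia.
Variables (R : realType) (d : nat).
Implicit Types A V P : 'M[R]_d.

Definition bform A (u v : 'rV[R]_d) : R := (u *m A *m v^T) 0 0.

Lemma bformDl A u u' v : bform A (u + u') v = bform A u v + bform A u' v.
Proof. by rewrite /bform !mulmxDl mxE. Qed.

Lemma bformZl A a u v : bform A (a *: u) v = a * bform A u v.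
Proof. by rewrite /bform -!scalemxAl mxE. Qed.

Lemma bformZr A a u v : bform A u (a *: v) = a * bform A u v.
Proof. by rewrite /bform linearZ -scalemxAr mxE. Qed.

Lemma bformC A u v : A^T = A -> bform A u v = bform A v u.
Proof.
move=> symA; rewrite /bform -[in LHS](trmxK (u *m A *m v^T)) [LHS]mxE.
by rewrite !trmx_mul trmxK symA mulmxA.
Qed.

Lemma bformDD A u v : A^T = A ->
  bform A (u + v) (u + v) = bform A u u + bform A u v *+ 2 + bform A v v.
Proof.
move=> symA; rewrite bformDl ![bform A _ (u + v)]bformC// !bformDl.
by rewrite (bformC v u symA); ring.
Qed.

Lemma bform_kerl A u v : (u <= kermx A)%MS -> bform A u v = 0.
Proof. by move/sub_kermxP => uA; rewrite /bform uA mul0mx mxE. Qed.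

(** The value of the form at [t u + v] is affine in [t] with slope [2 b]; being nonnegative for
    every [t], it has slope zero. *)
Lemma bform_isotropic_nneg A (P : 'M[R]_d) u v : A^T = A ->
  (forall x, (x <= P)%MS -> 0 <= bform A x x) ->
  (u <= P)%MS -> (v <= P)%MS -> bform A u u = 0 -> bform A u v = 0.
Proof.
move=> symA nneg uP vP u0.
pose b := bform A u v; pose c := bform A v v.
have q t : 0 <= t * b *+ 2 + c.
  have := nneg _ (addmx_sub (scalemx_sub t uP) vP).
  by rewrite bformDD// !bformZl bformC// bformZl u0 !mulr0 add0r.
apply/eqP/negP => /negP b0.
(* At this [t] the affine function equals [- c - 2], which is negative. *)
have := q (- (c + 1) / b); rewrite divfK// -/b -/c.
have c0 : 0 <= c by exact: nneg.
lra.
Qed.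

(* For [V] negative definite of maximal rank, the complement of [kermx A] in
   the orthogonal of [V] is positive definite, by Cauchy-Schwarz. *)
Lemma negative_index_opp A k : A^T = A -> negative_index A k ->
  negative_index (- A) (\rank A - k).
Proof.
move=> symA [[V negV rV] maxV].
have posE (u : 'rV[R]_d) : (u *m - A *m u^T) 0 0 = - bform A u u.
  by rewrite mulmxN mulNmx mxE.
pose orth := kermx (A *m V^T).
have orthP u v : (u <= orth)%MS -> (v <= V)%MS -> bform A u v = 0.
  move=> /sub_kermxP uA /submxP[a ->].
  by rewrite /bform trmx_mul mulmxA -(mulmxA u) uA mul0mx mxE.
have ker_orth : (kermx A <= orth)%MS.
  by apply/sub_kermxP; rewrite mulmxA mulmx_ker mul0mx.
(* The rank of [A *m V^T] is at most [k], so its kernel has dimension at least [d - k]. *)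
have rorth : (d <= \rank orth + k)%N.
  have := mxrankM_maxr A V^T; rewrite mxrank_tr rV => rAV.
  by rewrite mxrank_ker -leq_subLR subKn ?rank_leq_row.
have rker : \rank (kermx A) = (d - \rank A)%N by rewrite mxrank_ker.
(* Otherwise [u] lies outside [V], and adjoining it gives a negative definite space of rank above
   [k], against [maxV]. *)
have nneg u : (u <= orth)%MS -> 0 <= bform A u u.
  move=> uo; rewrite leNgt; apply/negP => neg.
  have uV : ~~ (u <= V)%MS.
    by apply/negP => /(orthP _ _ uo) u0; rewrite u0 ltxx in neg.
  have : (\rank (V + <<u>>)%MS <= k)%N.
    apply: maxV => x /sub_addsmxP[[a b] /= ->] nz.
    set y := a *m V; have yV : (y <= V)%MS by exact: submxMl.
    have /sub_rVP[c cE] : (b *m <<u>>%MS <= u)%MS.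
      by rewrite (submx_trans (submxMl _ _))// genmxE.
    rewrite cE -/(bform A _ _) in nz *.
    rewrite bformDD// !bformZl !bformZr (bformC y)// (orthP _ _ uo yV).
    rewrite mulr0 mul0rn addr0 mulrA -expr2.
    have [y0|y0] := eqVneq y 0; last first.
      by rewrite ltr_wnDr ?negV// mulr_ge0_le0 ?sqr_ge0 ?ltW.
    move: nz; rewrite -/y y0 add0r scaler_eq0 negb_or => /andP[c0 _].
    by rewrite /bform mul0mx mul0mx mxE add0r pmulr_rlt0// exprn_even_gt0.
  rewrite leqNgt -rV => /negP; apply.
  suff : (V < V + <<u>>)%MS by rewrite ltmxErank => /andP[].
  rewrite ltmxE addsmxSl /=; apply: contra uV; apply: submx_trans.
  by rewrite -(genmxE u) addsmxSr.
have capV0 : (V :&: orth)%MS = 0.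
  apply/eqP; rewrite -submx0; apply/rV_subP => x; rewrite sub_capmx => /andP[xV xo].
  have [->|x0] := eqVneq x 0; first exact: sub0mx.
  by have := negV _ xV x0; rewrite -/(bform A x x) orthP// ltxx.
have capVker0 : (V :&: kermx A)%MS = 0.
  by apply/eqP; rewrite -submx0 -capV0 capmxS.
have full m (v : 'M[R]_(m, d)) : (v <= V + orth)%MS.
  apply: submx_full; rewrite /row_full eqn_leq rank_leq_col mxrank_disjoint_sum//.
  by rewrite rV addnC.
(* An isotropic [u] in [P] is orthogonal to [orth] by [bform_isotropic_nneg] and to [V] by
   construction, hence to the whole space by [full]. It then lies in [kermx A], which meets [P]
   trivially. *)
pose P := (orth :\: kermx A)%MS.
have negP : negative_definite_on (- A) P.
  move=> u uP u0; have uo : (u <= orth)%MS := submx_trans uP (diffmxSl _ _).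
  rewrite posE oppr_lt0 lt_def nneg// andbT; apply: contraNneq u0 => uu0.
  have uA : (u <= kermx A)%MS.
    apply/sub_kermxP/rowP => j; rewrite [RHS]mxE.
    have : bform A u (delta_mx 0 j) = 0.
      have /sub_addsmxP[[a b] /= ->] := full _ (delta_mx 0 j : 'rV_d).
      rewrite bformC// bformDl ![bform A _ u]bformC//.
      rewrite (orthP _ _ uo (submxMl _ _)) add0r.
      exact: (bform_isotropic_nneg symA nneg uo (submxMl _ _)).
    by rewrite /bform trmx_delta -colE mxE.
  by rewrite -submx0 -(capmx_diff orth (kermx A)) sub_capmx uP uA.
(* The form of [A] is nonpositive on [V + kermx A], of dimension [k + (d - \rank A)], so [Q] meets
   it only in zero. *)
have leP Q : negative_definite_on (- A) Q -> (\rank Q <= \rank A - k)%N.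
  move=> posQ.
  have cap0 : (Q :&: (V + kermx A))%MS = 0.
    apply/eqP; rewrite -submx0; apply/rV_subP => x.
    rewrite sub_capmx => /andP[xQ /sub_addsmxP[[a b] /= xE]].
    have [->|x0] := eqVneq x 0; first exact: sub0mx.
    have := posQ _ xQ x0; rewrite posE oppr_lt0 xE bformDD//.
    rewrite (bformC (a *m V))// !(bform_kerl _ (submxMl _ _)) mul0rn !addr0.
    have [->|y0] := eqVneq (a *m V) 0.
      by rewrite /bform mul0mx mul0mx mxE ltxx.
    by move=> /(lt_trans (negV _ (submxMl _ _) y0)); rewrite ltxx.
  have := rank_leq_row (Q + (V + kermx A))%MS.
  have := rank_leq_row A.
  rewrite !mxrank_disjoint_sum// rV rker; lia.
split; last exact: leP.
exists P => //; apply/eqP; rewrite eqn_leq leP//=.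
have := mxrank_cap_compl orth (kermx A).
have : (\rank (orth :&: kermx A) <= d - \rank A)%N.
  by rewrite -rker mxrankS// capmxSr.
have := rank_leq_row A.
rewrite -/P; lia.
Qed.
End Inertia.

Lemma negative_indexZ (R : realType) d (A : 'M[R]_d) (c : R) k :
  0 < c -> negative_index (c *: A) k <-> negative_index A k.
Proof.
move=> c0.
have negE V : negative_definite_on (c *: A) V <-> negative_definite_on A V.
  have cE u : ((u *m (c *: A) *m u^T) 0 0 < 0) = ((u *m A *m u^T) 0 0 < 0).
    by rewrite -scalemxAr -scalemxAl mxE pmulr_rlt0.
  by split=> negV u uV u0; have := negV u uV u0; rewrite cE.
split=> -[[V negV rV] maxV]; split.
- by exists V => //; exact/negE.
- by move=> W /negE; exact: maxV.
- by exists V => //; exact/negE.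
- by move=> W /negE; exact: maxV.
Qed.

(** Scaling by [- c], which is positive, preserves the index, so only negation remains. The bound on
    [m + k] says [k <= \rank A], which makes the truncated [\rank A - k] an involution, as the
    converse requires. *)
Lemma negative_indexZ_dual (R : realType) d (A : 'M[R]_d) (c : R) m k :
  A^T = A -> c < 0 -> (d - \rank A)%N = m -> (m + k <= d)%N ->
  negative_index (c *: A) k <-> negative_index A (d - m - k).
Proof.
move=> symA c0 rk mk; have rA := rank_leq_row A.
have -> : (d - m - k = \rank A - k)%N by lia.
have symNA : (- A)^T = - A by rewrite linearN /= symA.
rewrite -[c]opprK scaleNr -scalerN negative_indexZ ?oppr_gt0//; split=> idx.
  by have := negative_index_opp symNA idx; rewrite opprK mxrank_opp.
have := negative_index_opp symA idx.
by congr negative_index; lia.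
Qed.

(** * Hessians: symmetry, and affine changes of the function's values *)

Section Hessian.
Variables (R : realType) (d : nat) (U : set 'rV[R]_d).
Hypothesis openU : open U.

Lemma hessian_sym (h : 'rV[R]_d -> R) u :
  U u -> Ck_on U 2 h -> (hessian h u)^T = hessian h u.
Proof.
by move=> Uu Ch; apply/matrixP => i j; rewrite !mxE; exact: derive_comm Uu Ch.
Qed.

Lemma derive_affine (h : 'rV[R]_d -> R) (a b : R) u v :
  derivable h u v -> 'D_v (fun x => a * h x + b) u = a * 'D_v h u.
Proof.
move=> dh; transitivity ('D_v ((a \*: h) + cst b) u); first by [].
rewrite (deriveD (@derivableZ _ _ _ h a u v dh) (@derivable_cst _ _ _ b u v)).
by rewrite derive_cst addr0; exact: deriveZ.
Qed.

Lemma hessian_affine (h : 'rV[R]_d -> R) (a b : R) u :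
  U u -> Ck_on U 2 h -> hessian (fun x => a * h x + b) u = a *: hessian h u.
Proof.
move=> Uu [_ Ch]; apply/matrixP => i j; rewrite !mxE.
have [dj [_ /(_ (delta_mx 0 i))[dij _]]] := Ch (delta_mx 0 j).
(* The first derivative is again of affine form, with constant term [0], but only on [U]; the two
   sides are therefore compared near [u]. *)
transitivity ('D_(delta_mx 0 i) (fun x => a * 'D_(delta_mx 0 j) h x + 0) u).
  apply: near_eq_derive; apply: (nbhs_open_eq openU _ Uu) => y Uy.
  by rewrite addr0 derive_affine//; exact: dj.
by rewrite derive_affine//; exact: dij.
Qed.

End Hessian.

(** * The parallel axis identity and the regularity of the squared distance *)

Section Spider.
Variables (R : realType) (n : nat) (S : spider_mechanism R n) (w : 'I_n -> R).

Lemma enorm_sqr (x : 'rV[R]_2) : enorm x ^+ 2 = \sum_(k < 2) x 0 k ^+ 2.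
Proof. by rewrite sqr_sqrtr// sumr_ge0// => k _; exact: sqr_ge0. Qed.

Hypothesis W0 : \sum_(i < n) w i != 0.

(** In each coordinate the two sides differ by [2 (x - z)] times the sum of [w i (z - a_i)], which
    vanishes by the choice of [z]. *)
Lemma hooke_potentialE x :
  hooke_potential S w x = (\sum_(i < n) w i) * enorm (x - gravity_centre S w) ^+ 2
    + hooke_potential S w (gravity_centre S w).
Proof.
set z := gravity_centre S w.
have zE k : (\sum_(i < n) w i) * z 0 k = \sum_(i < n) w i * foot S i 0 k.
  rewrite mxE mulrA divff// mul1r summxE.
  by apply: eq_bigr => i _; rewrite mxE.
rewrite /hooke_potential mulr_suml -big_split/=.
under eq_bigr do rewrite enorm_sqr mulr_sumr.
under [RHS]eq_bigr do rewrite !enorm_sqr !mulr_sumr -big_split/=.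
rewrite exchange_big [RHS]exchange_big /=; apply: eq_bigr => k _.
apply/eqP; rewrite -subr_eq0 -sumrB; apply/eqP.
have e i : true -> w i * (x - foot S i) 0 k ^+ 2 -
    (w i * (x - z) 0 k ^+ 2 + w i * (z - foot S i) 0 k ^+ 2) =
    2 * (x 0 k - z 0 k) * (w i * z 0 k - w i * foot S i 0 k).
  by move=> _; rewrite !mxE; ring.
rewrite (eq_bigr _ e) -mulr_sumr sumrB -mulr_suml zE subrr mulr0//.
Qed.

(** Squaring removes the root in [enorm] and leaves a quadratic polynomial in two matrix entries of
    the configuration, those of the body's row. *)
Lemma Ck_on_sqdist (V : normedModType R) (U : set V) (phi : V -> ambient S) k :
  open U -> Ck_on U k phi -> Ck_on U k (@sqdist_to_gravity_centre R n S w \o phi).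
Proof.
move=> oU Cphi; pose z := gravity_centre S w.
pose q (j : 'I_2) : V -> R := (fun x => phi x (enum_rank None) j) + cst (- z 0 j).
have Cq j : Ck_on U k (q j).
  by apply: Ck_onD => //; [exact: Ck_on_coord|exact: Ck_on_cst].
apply: (@Ck_on_ext _ _ _ oU _ _ (q 0 * q 0 + q 1 * q 1)); last first.
  by apply: Ck_onD => //; exact: Ck_onM.
move=> y _; have qE j : q j y = (body (phi y) - z) 0 j.
  by rewrite [RHS]mxE [X in _ = X + _]mxE [X in _ = _ + X]mxE.
rewrite /= /sqdist_to_gravity_centre enorm_sqr big_ord_recl big_ord1 -!qE !expr2.
by rewrite (_ : lift ord0 ord0 = 1)//; exact: val_inj.
Qed.

End Spider.

(** * Comparison of the two functions in a common parametrization *)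

Theorem theorem3 (R : realType) (n : nat) (S : spider_mechanism R n)
    (w : 'I_n -> R) :
  smooth_spider_space S ->
  \sum_(i < n) w i != 0 ->
  (0 < \sum_(i < n) w i ->
     same_critical_theory (@spider_space R n S) (spider_dim S)
       (@hooke_energy R n S w) (@sqdist_to_gravity_centre R n S w)) /\
  (\sum_(i < n) w i < 0 ->
     dual_critical_theory (@spider_space R n S) (spider_dim S)
       (@hooke_energy R n S w) (@sqdist_to_gravity_centre R n S w)).
Proof.
move=> _; set W := \sum_(i < n) w i => W0.
set M := @spider_space R n S; set d := spider_dim S.
set f := @hooke_energy R n S w; set g := @sqdist_to_gravity_centre R n S w.
pose c := hooke_potential S w (gravity_centre S w).
have fE xi : f xi = W * g xi + c := hooke_potentialE S W0 (body xi).
have C2g (xi : ambient S) (U : set 'rV[R]_d) phi :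
    local_parametrization M xi U phi -> Ck_on U 2 (g \o phi).
  by case=> oU _ _ sphi *; exact: Ck_on_sqdist.
have fphi (phi : 'rV[R]_d -> ambient S) : f \o phi = fun x => W * (g \o phi) x + c.
  by apply/funext => x; exact: fE.
have critE xi U (phi : 'rV[R]_d -> ambient S) : local_parametrization M xi U phi ->
    (forall v, 'D_v (f \o phi) 0 = 0) <-> (forall v, 'D_v (g \o phi) 0 = 0).
  move=> P; have [_ dg] := C2g _ _ _ P.
  have DE v : 'D_v (f \o phi) 0 = W * 'D_v (g \o phi) 0.
    by rewrite fphi derive_affine//; apply: (dg v).1; exact: param_dom0 P.
  split=> crit v; last by rewrite DE crit mulr0.
  by apply: (mulfI W0); rewrite -DE crit mulr0.
have hessE xi U (phi : 'rV[R]_d -> ambient S) : local_parametrization M xi U phi ->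
    hessian (f \o phi) 0 = W *: hessian (g \o phi) 0.
  move=> P; rewrite fphi; apply: hessian_affine (C2g _ _ _ P).
    exact: param_open P.
  exact: param_dom0 P.
have rankE xi U (phi : 'rV[R]_d -> ambient S) : local_parametrization M xi U phi ->
    \rank (hessian (f \o phi) 0) = \rank (hessian (g \o phi) 0).
  by move=> P; rewrite (hessE _ _ _ P) mxrank_scale_nz.
(* Here and below, the parametrization that witnesses the property for one function is reused for
   the other. *)
have crit_pt xi : critical_point M d f xi <-> critical_point M d g xi.
  by split=> -[U [phi [P /(critE _ _ _ P) cr]]]; exists U, phi.
split=> sgn; (split; first by move=> xi _; exact: crit_pt).
- move=> xi m k _; split=> -[U [phi [P /(critE _ _ _ P) cr rk idx]]];
    exists U, phi; (split; [exact: P|exact: cr| |]).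
  + by rewrite -(rankE _ _ _ P).
  + by apply/(negative_indexZ _ _ sgn); rewrite -(hessE _ _ _ P).
  + by rewrite (rankE _ _ _ P).
  + by rewrite (hessE _ _ _ P); apply/negative_indexZ.
- by move=> xi eta _ _; rewrite !fE lerD2r ler_pM2l.
- move=> xi m k _ mk.
  (* The nullity hypothesis is put on the Hessian of [g]; [rankE] transfers it when the data come
     from [f]. *)
  have idxE U (phi : 'rV[R]_d -> ambient S) : local_parametrization M xi U phi ->
      (d - \rank (hessian (g \o phi) 0))%N = m ->
      negative_index (hessian (f \o phi) 0) k <->
      negative_index (hessian (g \o phi) 0) (d - m - k).
    move=> P rk; rewrite (hessE _ _ _ P); apply: negative_indexZ_dual rk mk => //.
    by apply: (hessian_sym (param_open P) (param_dom0 P)); exact: C2g P.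
  split=> -[U [phi [P /(critE _ _ _ P) cr rk idx]]];
    exists U, phi; (split; [exact: P|exact: cr| |]).
  + by rewrite -(rankE _ _ _ P).
  + by rewrite (rankE _ _ _ P) in rk; exact: (idxE _ _ P rk).1 idx.
  + by rewrite (rankE _ _ _ P).
  + exact: (idxE _ _ P rk).2 idx.
- by move=> xi eta _ _; rewrite !fE lerD2r ler_nM2l.
Qed.
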